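(* Let $n,d\ge 1$ be integers and let $B$ be a base position in $[n]^d$. Run the greedy algorithm from $B$ (with any choice of the order in which white vertices are considered). Then $B$ is a solution if and only if the greedy algorithm terminates with $[n]^d$.
   Context: $[n]^d$ denotes the graph whose vertices (also called cubes) are the $d$-tuples $(x_1,\dots,x_d)$ with $x_i\in\{1,\dots,n\}$; two vertices are neighbours if they differ in exactly one coordinate, and in that coordinate by exactly $1$. A position is any subset of the vertices of $[n]^d$; its vertices are called black and the remaining vertices of $[n]^d$ are called white. A dismantling move removes from the current position a black vertex having exactly $d$ black neighbours in the current position. A build-up move adds to the current position a white vertex having exactly $d$ black neighbours in the current position. A base position is a set of $n^{d-1}$ pairwise non-neighbouring vertices of $[n]^d$. A solution is a base position that can be obtained from the full position $[n]^d$ by a finite sequence of dismantling moves. A position is maximal if no white vertex has exactly $d$ black neighbours. The greedy algorithm started from $B$ repeatedly traverses the white vertices, in any order, and adds (one at a time) any white vertex that currently has exactly $d$ black neighbours, until a maximal position is reached. *)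

(* Defs.v *)
From mathcomp Require Import all_boot.

Set Implicit Arguments.
Unset Strict Implicit.
Unset Printing Implicit Defensive.

(* Coordinates are numbered 0..d-1 and take values 0..n-1 instead of 1..n. *)
Definition cube (n d : nat) := {ffun 'I_d -> 'I_n}.

Definition adjacent (n d : nat) (x y : cube n d) : bool :=
  [exists i, (((x i).+1 == y i :> nat) || ((y i).+1 == x i :> nat))
             && [forall j, (j != i) ==> (x j == y j)]].

(* The set of black vertices. *)
Definition position (n d : nat) := {set cube n d}.

Definition black_neighbours (n d : nat) (P : position n d) (v : cube n d) :
    position n d :=
  [set w in P | adjacent v w].

Definition dismantlable (n d : nat) (P : position n d) (v : cube n d) : bool :=
  (v \in P) && (#|black_neighbours P v| == d).

Definition dismantling_move (n d : nat) (P Q : position n d) : bool :=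
  [exists v, dismantlable P v && (Q == P :\ v)].

Definition buildable (n d : nat) (P : position n d) (v : cube n d) : bool :=
  (v \notin P) && (#|black_neighbours P v| == d).

Definition base_position (n d : nat) (B : position n d) : Prop :=
  #|B| = n ^ d.-1 /\ {in B &, forall x y, ~~ adjacent x y}.

Definition solution (n d : nat) (B : position n d) : Prop :=
  base_position B /\ connect (@dismantling_move n d) setT B.

Definition maximal (n d : nat) (P : position n d) : bool :=
  [forall v, ~~ buildable P v].

(* One traversal: each vertex of s is tested against the current position,
   which includes the vertices added earlier in the same traversal. *)
Definition traversal (n d : nat) (s : seq (cube n d)) (P : position n d) :
    position n d :=
  foldl (fun Q v => if buildable Q v then v |: Q else Q) P s.

(* ord k P lists the vertices white in P, in the order in which the k-th
   traversal visits them if it starts from P.  Every sequence of choices made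
   in a run of the algorithm arises from some such ord. *)
Definition traversal_order (n d : nat)
    (ord : nat -> position n d -> seq (cube n d)) : Prop :=
  forall k P, perm_eq (ord k P) (enum (~: P)).

(* greedy_from ord k P Q: the algorithm, in position P after k traversals,
   halts, and its final position is Q. *)
Inductive greedy_from (n d : nat)
    (ord : nat -> position n d -> seq (cube n d)) :
    nat -> position n d -> position n d -> Prop :=
| greedy_stop k P : maximal P -> greedy_from ord k P P
| greedy_traverse k P Q :
    ~~ maximal P -> greedy_from ord k.+1 (traversal (ord k P) P) Q ->
    greedy_from ord k P Q.

Definition greedy_terminates_with (n d : nat)
    (ord : nat -> position n d -> seq (cube n d)) (B Q : position n d) : Prop :=
  greedy_from ord 0 B Q.

(* Main.v *)
Require Import Defs.
From mathcomp Require Import all_boot zify.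

(** Write [e P] for the number of edges spanned by the position [P]. A build-up
    move adds exactly [d] edges, so [e P - d * #|P|] does not change during
    build-up. Suppose that the full position can be built up from [B] and that
    greedy stops in a maximal position [M] which is not full. Add to [M], in the
    order of the successful build-up, the vertices that [M] lacks: each one has
    at least [d] black neighbours when it is added, and the first one has more
    than [d], as [M] is maximal. So [e P - d * #|P|] is strictly larger for the
    full position than for [M], although both values equal that for [B]. *)

Set Implicit Arguments.
Unset Strict Implicit.
Unset Printing Implicit Defensive.

Section Confluence.

Variables n d : nat.
Implicit Types (P Q M B : position n d) (v x y : cube n d) (s : seq (cube n d)).

Lemma adjacent_irr : irreflexive (@adjacent n d).
Proof.
by move=> x; apply/existsP=> -[i /andP[+ _]]; lia.
Qed.

Lemma adjacent_sym : symmetric (@adjacent n d).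
Proof.
move=> x y; rewrite /adjacent; apply: eq_existsb => i.
rewrite orbC; congr (_ && _).
by apply: eq_forallb => j; rewrite [x j == y j]eq_sym.
Qed.

Lemma black_neighbours_addE P v :
  black_neighbours (v |: P) v = black_neighbours P v.
Proof.
apply/setP=> x; rewrite !inE; case: (eqVneq x v) => [->|_] //=.
by rewrite adjacent_irr andbF.
Qed.

Lemma black_neighboursS P Q v :
  P \subset Q -> #|black_neighbours P v| <= #|black_neighbours Q v|.
Proof.
move=> /subsetP sPQ; apply: subset_leq_card; apply/subsetP=> x.
by rewrite !inE => /andP[/sPQ-> ->].
Qed.

(** Each edge is counted from both ends, so this is [2 * e P], and a build-up move raises it by
    [2 * d]. *)
Definition double_edges P : nat := \sum_(x in P) #|black_neighbours P x|.

Lemma double_edges_add P v : v \notin P ->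
  double_edges (v |: P) = double_edges P + 2 * #|black_neighbours P v|.
Proof.
move=> vP; rewrite /double_edges big_setU1 //= black_neighbours_addE.
have -> : \sum_(x in P) #|black_neighbours (v |: P) x| =
          \sum_(x in P) (#|black_neighbours P x| + adjacent v x).
  apply: eq_bigr => x xP; rewrite (cardsD1 v) addnC !inE eqxx /= adjacent_sym.
  congr (_ + _); apply: eq_card => y; rewrite !inE.
  by case: (eqVneq y v) => [->|_] //=; rewrite (negPf vP).
rewrite big_split /=.
have -> : \sum_(x in P) adjacent v x = #|black_neighbours P v|.
  rewrite -sum1_card -big_mkcondr /=.
  by apply: eq_bigl => x; rewrite inE.
by rewrite addnCA addnn mul2n.
Qed.

(** Build-up reverses dismantling: a vertex is not its own neighbour, so its number of black
    neighbours is the same before and after it is added. *)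
Lemma dismantling_moveP P Q :
  reflect (exists2 v, buildable P v & Q = v |: P) (dismantling_move Q P).
Proof.
apply: (iffP existsP) => [[v /andP[/andP[vQ nb] /eqP->]]|[v /andP[vP nb] ->]];
  exists v; last first.
  by rewrite /dismantlable setU11 black_neighbours_addE nb setU1K //=.
  by rewrite setD1K.
by rewrite /buildable setD11 -black_neighbours_addE setD1K.
Qed.

Lemma built_up_ind (B : position n d) (R : position n d -> Prop) :
    R B -> (forall P v, R P -> buildable P v -> R (v |: P)) ->
  forall Q, connect (@dismantling_move n d) Q B -> R Q.
Proof.
move=> RB Radd Q /connectP[p]; elim: p Q => [|P p IH] Q /= => [_ <- //|].
by case/andP=> /dismantling_moveP[v vP ->] /IH{}IH /IH RP; apply: Radd.
Qed.

Lemma built_up_sub B Q : connect (@dismantling_move n d) Q B -> B \subset Q.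
Proof.
move: Q; apply: built_up_ind => // P v sBP _.
by apply: subset_trans sBP _; apply: subsetUr.
Qed.

(** The invariance of [e P - d * #|P|], doubled and with terms moved across to avoid truncated
    subtraction. *)
Lemma built_up_edges B Q : connect (@dismantling_move n d) Q B ->
  double_edges Q + 2 * d * #|B| = double_edges B + 2 * d * #|Q|.
Proof.
move: Q; apply: built_up_ind => // P v IH /andP[vP /eqP nb].
by rewrite double_edges_add // nb cardsU1 vP; lia.
Qed.

(** Induction along the build-up of [Q]: vertices of [M] change nothing, the first one outside [M]
    yields the strict inequality, and later ones preserve it. *)
Lemma maximal_built_up_sub_or_edges B M Q :
    B \subset M -> maximal M -> connect (@dismantling_move n d) Q B ->
  Q \subset M \/
  double_edges M + 2 * d * #|M :|: Q| < double_edges (M :|: Q) + 2 * d * #|M|.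
Proof.
move=> sBM /forallP maxM; move: Q; apply: built_up_ind; first by left.
move=> P v IH /andP[vP /eqP nb]; rewrite setUCA.
have [vMP|vMP] := boolP (v \in M :|: P).
  have -> : v |: (M :|: P) = M :|: P by apply/setUidPr; rewrite sub1set.
  case: IH => [sPM|]; [left | by right].
  by rewrite subUset sPM sub1set andbT; move: vMP; rewrite (setUidPl sPM).
right; rewrite double_edges_add // cardsU1 vMP.
have := black_neighboursS v (subsetUr M P); rewrite nb.
case: IH => [sPM|]; last by lia.
(* Here [v] is white in [M] with at least [d] black neighbours, and by maximality not exactly
   [d]. *)
move: vMP; rewrite (setUidPl sPM) => vM; move: (maxM v).
by rewrite /buildable vM /=; lia.
Qed.

Lemma maximal_built_up_setT B M :
    maximal M -> connect (@dismantling_move n d) M B ->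
    connect (@dismantling_move n d) setT B ->
  M = setT.
Proof.
move=> maxM MB TB; have sBM := built_up_sub MB.
have := maximal_built_up_sub_or_edges sBM maxM TB.
rewrite subTset setUT => -[/eqP //|].
by have := built_up_edges MB; have := built_up_edges TB; lia.
Qed.

Lemma traversal_built_up s P :
  connect (@dismantling_move n d) (traversal s P) P.
Proof.
elim: s P => [|v s IH] P /=; first exact: connect0.
apply: connect_trans (IH _) _; case: ifP => [bv|_]; last exact: connect0.
by apply/connect1/dismantling_moveP; exists v.
Qed.

Lemma traversal_id s P v : traversal s P = P -> v \in s -> ~~ buildable P v.
Proof.
elim: s => //= u s IH; case: ifP => [bu|/negbT bu] Ps; last first.
  by rewrite inE => /predU1P[->|/(IH Ps)].
(* An added [u] would survive to the end of the traversal, whose result [P] does not contain it. *)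
have /subsetP/(_ u (setU11 _ _)) := built_up_sub (traversal_built_up s (u |: P)).
by rewrite Ps; case/andP: bu => /negPf->.
Qed.

Section Greedy.

Variable ord : nat -> position n d -> seq (cube n d).

Lemma greedy_from_built_up k P Q :
  greedy_from ord k P Q -> connect (@dismantling_move n d) Q P.
Proof.
elim=> {k P Q} [k P _|k P Q _ _ IH]; first exact: connect0.
exact: connect_trans IH (traversal_built_up _ _).
Qed.

Lemma greedy_from_maximal k P Q : greedy_from ord k P Q -> maximal Q.
Proof. by elim. Qed.

Hypothesis ordP : traversal_order ord.

Lemma traversal_proper k P : ~~ maximal P -> P \proper traversal (ord k P) P.
Proof.
case/forallPn=> v /negPn bv.
rewrite properEneq built_up_sub ?traversal_built_up // andbT eq_sym.
apply: contraL bv => /eqP /traversal_id; have [vP _|vP] := boolP (v \in P).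
  by rewrite /buildable vP.
by apply; rewrite (perm_mem (ordP k P)) mem_enum inE.
Qed.

(** Each traversal of a non-maximal position adds a vertex, so the number of white vertices strictly
    decreases. *)
Lemma greedy_from_exists k P : exists Q, greedy_from ord k P Q.
Proof.
have [m] := ubnP #|~: P|; elim: m k P => // m IH k P ltPm.
have [maxP|maxP] := boolP (maximal P); first by exists P; constructor.
have [|Q gQ] := IH k.+1 (traversal (ord k P) P); last first.
  by exists Q; apply: greedy_traverse.
rewrite ltnS in ltPm; apply: leq_trans ltPm.
by apply: proper_card; rewrite properC traversal_proper.
Qed.

End Greedy.

End Confluence.

Theorem corollary2 (n d : nat) (hn : 1 <= n) (hd : 1 <= d)
  (B : position n d) (hB : base_position B)
  (ord : nat -> position n d -> seq (cube n d)) (hord : traversal_order ord) :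
  solution B <-> greedy_terminates_with ord B [set: cube n d].
Proof.
split=> [[_ TB]|/greedy_from_built_up TB]; last by split.
(* The run halts in some maximal [Q] built up from [B], and the edge count forces [Q] to be full. *)
have [Q gQ] := greedy_from_exists hord 0 B.
rewrite /greedy_terminates_with.
by rewrite -(maximal_built_up_setT (greedy_from_maximal gQ)
  (greedy_from_built_up gQ) TB).
Qed.
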